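(* Let $L(V)$ be the Kantor Lie-double of the Virasoro-like algebra, a complex Lie superalgebra with bracket $[\cdot,\cdot]$. For every complex number $\delta$, every transposed $\delta$-Poisson superalgebra structure $(L(V),\cdot,[\cdot,\cdot])$ on $(L(V),[\cdot,\cdot])$ is trivial; that is, $L(V)$ admits no nontrivial transposed $\delta$-Poisson superalgebra structures.
   Context: For $\mathbf{m}=(m_1,m_2),\mathbf{n}=(n_1,n_2)\in\mathbb{Z}^2$ write $\det\binom{\mathbf{n}}{\mathbf{m}}=n_1m_2-n_2m_1$. The Kantor Lie-double $L(V)=L(V)_{\overline 0}\oplus L(V)_{\overline 1}$ of the Virasoro-like algebra is the complex Lie superalgebra whose even part $L(V)_{\overline 0}$ has basis $\{L_{\mathbf{m}}\mid\mathbf{m}\in\mathbb{Z}^2\setminus\{\mathbf{0}\}\}$, whose odd part $L(V)_{\overline 1}$ has basis $\{G_{\mathbf{m}}\mid\mathbf{m}\in\mathbb{Z}^2\setminus\{\mathbf{0}\}\}$, and whose bracket is $[L_{\mathbf{m}},L_{\mathbf{n}}]=\det\binom{\mathbf{n}}{\mathbf{m}}L_{\mathbf{m}+\mathbf{n}}$, $[L_{\mathbf{m}},G_{\mathbf{n}}]=\det\binom{\mathbf{n}}{\mathbf{m}}G_{\mathbf{m}+\mathbf{n}}=[G_{\mathbf{m}},L_{\mathbf{n}}]$, $[G_{\mathbf{m}},G_{\mathbf{n}}]=L_{\mathbf{m}+\mathbf{n}}$, with the convention $L_{\mathbf{0}}=0$, $G_{\mathbf{0}}=0$. Let $\delta\in\mathbb{C}$.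 A transposed $\delta$-Poisson superalgebra is a triple $(L,\cdot,[\cdot,\cdot])$ on a $\mathbb{Z}_2$-graded vector space $L=L_{\overline 0}\oplus L_{\overline 1}$ such that $(L,\cdot)$ is a supercommutative associative superalgebra (not necessarily unital), $(L,[\cdot,\cdot])$ is a Lie superalgebra, and $x\cdot[y,z]=\delta([x\cdot y,z]+(-1)^{|x||y|}[y,x\cdot z])$ for all homogeneous $x,y,z$, where $|x|$ is the degree of $x$. It is called trivial if $L\cdot L=0$ or $[L,L]=0$. A transposed $\delta$-Poisson superalgebra structure on a Lie superalgebra $(L,[\cdot,\cdot])$ is a product $\cdot$ making $(L,\cdot,[\cdot,\cdot])$ a transposed $\delta$-Poisson superalgebra. *)

(* Defs.v *)
From HB Require Import structures.
From mathcomp Require Import all_boot all_order all_algebra ring.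
From mathcomp Require Import finmap.
From mathcomp.multinomials Require Import monalg.
From mathcomp Require Import complex reals.

Set Implicit Arguments.
Unset Strict Implicit.
Unset Printing Implicit Defensive.

Import GRing.Theory.
Local Open Scope ring_scope.

(* Degrees are booleans, false being the even one; the zero vector is
   homogeneous of both degrees. *)
Record gradedSpace (K : fieldType) := GradedSpace {
  gspace :> lmodType K;
  homog : bool -> gspace -> Prop;
  homog0 : forall i, homog i 0;
  homogPZD : forall i (c : K) (u v : gspace),
    homog i u -> homog i v -> homog i (c *: u + v);
  homog_sum : forall x : gspace,
    exists u v, [/\ homog false u, homog true v & x = u + v];
  homog_direct : forall x : gspace, homog false x -> homog true x -> x = 0
}.

Section Superalgebras.

Variables (K : fieldType) (L : gradedSpace K).
Implicit Types (op mul br : L -> L -> L) (x y z : L) (i j k : bool).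

Definition superalgebra op : Prop :=
  bilinear_for *:%R *:%R op /\
  forall i j x y, homog i x -> homog j y -> homog (i (+) j) (op x y).

Definition ssign i j : K := (-1) ^+ (i && j).

Definition supercommutative op : Prop :=
  forall i j x y, homog i x -> homog j y -> op x y = ssign i j *: op y x.

Definition super_skewsymmetric op : Prop :=
  forall i j x y, homog i x -> homog j y -> op x y = - (ssign i j *: op y x).

Definition super_jacobi op : Prop :=
  forall i j k x y z, homog i x -> homog j y -> homog k z ->
    op x (op y z) = op (op x y) z + ssign i j *: op y (op x z).

Definition supercommutative_associative_superalgebra mul : Prop :=
  [/\ superalgebra mul, associative mul & supercommutative mul].

Definition lie_superalgebra br : Prop :=
  [/\ superalgebra br, super_skewsymmetric br & super_jacobi br].

Definition transposed_poisson_superalgebra (delta : K) mul br : Prop :=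
  [/\ supercommutative_associative_superalgebra mul,
      lie_superalgebra br &
      forall i j k x y z, homog i x -> homog j y -> homog k z ->
        mul x (br y z) =
          delta *: (br (mul x y) z + ssign i j *: br y (mul x z))].

Definition trivial_structure mul br : Prop :=
  (forall x y, mul x y = 0) \/ (forall x y, br x y = 0).

End Superalgebras.

Section LinearExtension.

Variables (K : fieldType) (I : choiceType) (V : lmodType K).
Implicit Types (f g : I -> V) (a b : {malg K[I]}).

Definition lin_ext f a : V := \sum_(k <- msupp a) a@_k *: f k.

Lemma lin_extEw f a (d : {fset I}) :
  (msupp a `<=` d)%fset -> lin_ext f a = \sum_(k <- d) a@_k *: f k.
Proof.
move=> le; apply: big_fset_incl => // k _ /mcoeff_outdom ->.
by rewrite scale0r.
Qed.

Lemma lin_ext_linear f : linear (lin_ext f).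
Proof.
move=> c a b; set d := (msupp (c *: a + b) `|` (msupp a `|` msupp b))%fset.
have le1 : (msupp (c *: a + b) `<=` d)%fset by rewrite fsubsetUl.
have le2 : (msupp a `<=` d)%fset.
  by rewrite (fsubset_trans (fsubsetUl _ (msupp b))) // fsubsetUr.
have le3 : (msupp b `<=` d)%fset.
  by rewrite (fsubset_trans (fsubsetUr (msupp a) _)) // fsubsetUr.
rewrite (lin_extEw _ le1) (lin_extEw _ le2) (lin_extEw _ le3).
rewrite scaler_sumr -big_split /=.
by apply: eq_bigr => k _; rewrite mcoeffD mcoeffZ scalerDl scalerA.
Qed.

Lemma lin_ext_linear_fun c f g h a : (forall k, h k = c *: f k + g k) ->
  lin_ext h a = c *: lin_ext f a + lin_ext g a.
Proof.
move=> hE; rewrite /lin_ext scaler_sumr -big_split; apply: eq_bigr => k _ /=.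
by rewrite hE scalerDr !scalerA (mulrC c).
Qed.

Lemma lin_extU f k : lin_ext f << k >> = f k.
Proof. by rewrite /lin_ext msuppU oner_eq0 big_seq_fset1 mcoeffUU scale1r. Qed.

Lemma malg_lin_ext a : a = \sum_(k <- msupp a) a@_k *: (<< k >> : {malg K[I]}).
Proof.
rewrite {1}[a]monalgE; apply: eq_bigr => k _; apply/malgP => l.
by rewrite mcoeffZ !mcoeffU mulrnAr mulr1.
Qed.

End LinearExtension.

Definition det2 (n m : int * int) : int := n.1 * m.2 - n.2 * m.1.

Definition nzidx : choiceType := {m : int * int | m != 0}.

HB.instance Definition _ := SubType.on nzidx.

(* (false, m) indexes L_m and (true, m) indexes G_m. *)
Definition LVidx : choiceType := (bool * nzidx)%type.

Definition LVspace (K : fieldType) : lmodType K := {malg K[LVidx]}.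

Section KantorDouble.

Variable K : fieldType.

Definition LVhomog (i : bool) (x : LVspace K) : Prop :=
  forall p : LVidx, p \in msupp (x : {malg K[LVidx]}) -> p.1 = i.

Let LVhomogP i (x : {malg K[LVidx]}) :
  LVhomog i x <-> forall p : LVidx, p.1 != i -> x@_p = 0.
Proof.
split=> [h p pi|h p].
  by apply: mcoeff_outdom; apply: contra pi => /h ->.
by rewrite -mcoeff_neq0; case: (eqVneq p.1 i) => // /h ->; rewrite eqxx.
Qed.

Let LVhomog0 i : LVhomog i 0.
Proof. by apply/LVhomogP => p _; rewrite mcoeff0. Qed.

Let LVhomogPZD i c u v : LVhomog i u -> LVhomog i v -> LVhomog i (c *: u + v).
Proof.
move=> /LVhomogP hu /LVhomogP hv; apply/LVhomogP => p pi.
by rewrite mcoeffD mcoeffZ hu // hv // mulr0 addr0.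
Qed.

Let LVhomog_sum x :
  exists u v, [/\ LVhomog false u, LVhomog true v & x = u + v].
Proof.
pose u : {malg K[LVidx]} := [malg p in msupp x => if p.1 then 0 else x@_p].
have uE p : u@_p = if p.1 then 0 else x@_p.
  rewrite mcoeffE; case: ifP => // /negbT /mcoeff_outdom ->.
  by case: p.1.
exists u, (x - u); split; last by rewrite addrC subrK.
  by apply/LVhomogP => p; rewrite uE; case: p.1.
by apply/LVhomogP => p; rewrite mcoeffB uE; case: p.1 => //; rewrite subrr.
Qed.

Let LVhomog_direct x : LVhomog false x -> LVhomog true x -> x = 0.
Proof.
move=> /LVhomogP h0 /LVhomogP h1; apply/malgP => p; rewrite mcoeff0.
by case E: p.1; [apply: h0 | apply: h1]; rewrite E.
Qed.

Definition LV : gradedSpace K :=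
  GradedSpace LVhomog0 LVhomogPZD LVhomog_sum LVhomog_direct.

(* L_m for i = false and G_m for i = true; it is 0 when m = 0. *)
Definition gen (i : bool) (m : int * int) : LV :=
  if insub m is Some k then << (i, k) : LVidx >> : {malg K[LVidx]} else 0.

Definition Lgen (m : int * int) : LV := gen false m.
Definition Ggen (m : int * int) : LV := gen true m.

(* Only used for nonzero m and n, but m + n may be 0. *)
Definition gen_bracket (i j : bool) (m n : int * int) : LV :=
  match i, j with
  | false, false => (det2 n m)%:~R *: Lgen (m + n)
  | false, true | true, false => (det2 n m)%:~R *: Ggen (m + n)
  | true, true => Lgen (m + n)
  end.

Definition LVbracket (x y : LV) : LV :=
  lin_ext (fun p : LVidx =>
    lin_ext (fun q : LVidx => gen_bracket p.1 q.1 (val p.2) (val q.2)) y) x.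

Let LVbracketPl c (u v y : LV) :
  LVbracket (c *: u + v) y = c *: LVbracket u y + LVbracket v y.
Proof. exact: lin_ext_linear. Qed.

Let LVbracketPr c (x u v : LV) :
  LVbracket x (c *: u + v) = c *: LVbracket x u + LVbracket x v.
Proof. by apply: lin_ext_linear_fun => p; apply: lin_ext_linear. Qed.

Lemma LVbracket_bilinear : bilinear_for *:%R *:%R LVbracket.
Proof.
by split=> [y c u v|x c u v]; [apply: LVbracketPl | apply: LVbracketPr].
Qed.

Let bracketDl x y z : LVbracket (x + y) z = LVbracket x z + LVbracket y z.
Proof. by rewrite -[x]scale1r LVbracketPl !scale1r. Qed.

Let bracketDr x y z : LVbracket x (y + z) = LVbracket x y + LVbracket x z.
Proof. by rewrite -[y]scale1r LVbracketPr !scale1r. Qed.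

Let bracket0l y : LVbracket 0 y = 0.
Proof. by apply: (addIr (LVbracket 0 y)); rewrite -bracketDl !add0r. Qed.

Let bracket0r x : LVbracket x 0 = 0.
Proof. by apply: (addIr (LVbracket x 0)); rewrite -bracketDr !add0r. Qed.

Let bracketZr c x y : LVbracket x (c *: y) = c *: LVbracket x y.
Proof. by rewrite -[c *: y]addr0 LVbracketPr bracket0r addr0. Qed.

Lemma gen0 i : gen i 0 = 0.
Proof. by rewrite /gen insubF ?eqxx. Qed.

Lemma genE i (k : nzidx) : gen i (val k) = << (i, k) : LVidx >> :> {malg K[LVidx]}.
Proof. by rewrite /gen valK. Qed.

Let LVbracket_genE i j (k l : nzidx) :
  LVbracket (gen i (val k)) (gen j (val l)) = gen_bracket i j (val k) (val l).
Proof. by rewrite /LVbracket !genE !lin_extU. Qed.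

Lemma LVbracket_gen i j m n : m != 0 -> n != 0 ->
  LVbracket (gen i m) (gen j n) = gen_bracket i j m n.
Proof.
by move=> m0 n0; apply: (LVbracket_genE i j (exist _ m m0) (exist _ n n0)).
Qed.

Let homog_gen i m : @homog K LV i (gen i m).
Proof.
rewrite /gen; case: insubP => [k _ _|_]; last exact: homog0.
by move=> p; rewrite msuppU oner_eq0 in_fset1 => /eqP ->.
Qed.

Lemma LVhomog_ind i (P : LV -> Prop) :
  P 0 -> (forall c u v, P u -> P v -> P (c *: u + v)) ->
  (forall m, m != 0 -> P (gen i m)) -> forall x, homog i x -> P x.
Proof.
move=> P0 PZD Pg x hx; rewrite [x]malg_lin_ext big_seq.
elim/big_rec: _ => // p y /hx Ep Py; apply: PZD => //.
have -> : << p >> = gen i (val p.2) by rewrite genE -Ep; case: (p).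
exact: Pg (valP p.2).
Qed.

Let coef (i j : bool) (m n : int * int) : K :=
  if i && j then 1 else (det2 n m)%:~R.

Let gen_bracketE i j m n :
  gen_bracket i j m n = coef i j m n *: gen (i (+) j) (m + n).
Proof. by case: i; case: j; rewrite /coef /= ?scale1r. Qed.

Let bracket_gen0 i j m n : ~~ (i && j) || (m != 0) && (n != 0) ->
  LVbracket (gen i m) (gen j n) = coef i j m n *: gen (i (+) j) (m + n).
Proof.
case: (eqVneq m 0) => [->|m0]; last case: (eqVneq n 0) => [->|n0].
- rewrite orbF gen0 bracket0l /coef => /negPf ->.
  by rewrite /det2 !mulr0 subrr scale0r.
- rewrite orbF gen0 bracket0r /coef => /negPf ->.
  by rewrite /det2 !mul0r subrr scale0r.
by move=> _; rewrite LVbracket_gen // gen_bracketE.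
Qed.

Let LVbracket_superalgebra : superalgebra LVbracket.
Proof.
split=> [|i j x y hx hy]; first exact: LVbracket_bilinear.
elim/(LVhomog_ind (i := i)): hx => [|c u v Pu Pv|m m0].
- by rewrite bracket0l; apply: homog0.
- by rewrite LVbracketPl; apply: homogPZD.
elim/(LVhomog_ind (i := j)): hy => [|c u v Pu Pv|n n0].
- by rewrite bracket0r; apply: homog0.
- by rewrite LVbracketPr; apply: homogPZD.
rewrite LVbracket_gen // gen_bracketE -[X in homog _ X]addr0.
by apply: homogPZD; [apply: homog_gen | apply: homog0].
Qed.

Let LVbracket_skew : super_skewsymmetric LVbracket.
Proof.
have aux (V : lmodType K) (c s : K) (u v : V) :
  c *: - (s *: u) + - (s *: v) = - (s *: (c *: u + v)).
  by rewrite scalerDr opprD scalerN !scalerA mulrC.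
move=> i j x y hx hy.
elim/(LVhomog_ind (i := i)): hx => [|c u v Pu Pv|m m0].
- by rewrite bracket0l bracket0r scaler0 oppr0.
- by rewrite LVbracketPl LVbracketPr Pu Pv aux.
elim/(LVhomog_ind (i := j)): hy => [|c u v Pu Pv|n n0].
- by rewrite bracket0l bracket0r scaler0 oppr0.
- by rewrite LVbracketPl LVbracketPr Pu Pv aux.
rewrite !LVbracket_gen // !gen_bracketE addbC [n + m]addrC scalerA -scaleNr.
congr (_ *: _); rewrite /coef /ssign andbC /det2.
by case: (j && i); rewrite ?expr1 ?expr0; ring.
Qed.

Let LVbracket_jacobi : super_jacobi LVbracket.
Proof.
have aux (V : lmodType K) (c s : K) (u v u' v' : V) :
  c *: (u + s *: u') + (v + s *: v') = c *: u + v + s *: (c *: u' + v').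
  by rewrite !scalerDr !scalerA (mulrC c) addrACA.
move=> i j k x y z hx hy hz.
elim/(LVhomog_ind (i := i)): hx => [|c u v Pu Pv|m m0].
- by rewrite !bracket0l bracket0r scaler0 addr0.
- by rewrite !LVbracketPl LVbracketPr Pu Pv aux.
elim/(LVhomog_ind (i := j)): hy => [|c u v Pu Pv|n n0].
- by rewrite !(bracket0l, bracket0r) scaler0 addr0.
- by rewrite LVbracketPl !LVbracketPr !LVbracketPl Pu Pv aux.
elim/(LVhomog_ind (i := k)): hz => [|c u v Pu Pv|p p0].
- by rewrite !bracket0r scaler0 addr0.
- by rewrite !LVbracketPr Pu Pv aux.
have nest a b c (m1 n1 p1 : int * int) : m1 != 0 -> n1 != 0 -> p1 != 0 ->
    LVbracket (gen a m1) (LVbracket (gen b n1) (gen c p1)) =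
    (coef b c n1 p1 * coef a (b (+) c) m1 (n1 + p1))
      *: gen (a (+) (b (+) c)) (m1 + (n1 + p1)).
  move=> m10 n10 p10; rewrite (LVbracket_gen b c) // gen_bracketE bracketZr.
  case: (eqVneq (n1 + p1) 0) => [E|np0]; last first.
    by rewrite bracket_gen0 ?m10 ?np0 ?orbT // scalerA.
  rewrite E gen0 bracket0r scaler0 /coef.
  have D0 : det2 p1 n1 = 0.
    by move/eqP: E; rewrite addr_eq0 => /eqP ->; rewrite /det2 /=; ring.
  have D1 : det2 0 m1 = 0 by rewrite /det2 /= !mul0r subrr.
  by rewrite D0 D1; case: a; case: b; case: c; rewrite /= ?mul0r ?mulr0 scale0r.
have E1 : LVbracket (LVbracket (gen i m) (gen j n)) (gen k p) =
  - (ssign K (i (+) j) k *: LVbracket (gen k p) (LVbracket (gen i m) (gen j n))).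
  apply: LVbracket_skew; last exact: homog_gen.
  by apply: LVbracket_superalgebra.2; apply: homog_gen.
rewrite E1 !nest //.
rewrite (_ : p + (m + n) = m + (n + p)); last by rewrite addrC addrA.
rewrite (_ : n + (m + p) = m + (n + p)); last by rewrite addrCA.
rewrite (_ : k (+) (i (+) j) = i (+) (j (+) k)); last by rewrite addbC addbA.
rewrite (_ : j (+) (i (+) k) = i (+) (j (+) k)); last by rewrite addbCA.
rewrite !scalerA -scaleNr -scalerDl; congr (_ *: _).
rewrite /coef /ssign /det2 /=.
by case: i {E1}; case: j; case: k; rewrite /= ?expr1 ?expr0; ring.
Qed.

Lemma LVbracket_lie : lie_superalgebra LVbracket.
Proof. by split. Qed.

End KantorDouble.

(* Main.v *)
(* If delta = 0 the product vanishes because [L(V), L(V)] = L(V).  Otherwise,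
   for odd x and u, computing [x,x].[u,x] from either factor shows that x.u
   commutes with [x,x]; by supercommutativity it also commutes with [u,u].
   Hence G_c.G_m commutes with L_{2c} and L_{2m}, which forces G_c.G_m = 0 when
   det(c,m) <> 0.  The transposed Leibniz rule spreads this vanishing: first to
   G.L, writing L_s = [G_a,G_b] with a, b not parallel to c, then to the
   remaining G.G, and finally to L.L. *)
Require Import Defs.
From mathcomp Require Import all_boot all_algebra complex reals.
From mathcomp Require Import ring zify finmap.
From mathcomp.multinomials Require Import monalg.

Set Implicit Arguments.
Unset Strict Implicit.
Unset Printing Implicit Defensive.

Import GRing.Theory Num.Theory.
Local Open Scope ring_scope.

(** * Elementary rules for bilinear operations *)

Section Bilinear.

Variables (K : fieldType) (V : lmodType K) (op : V -> V -> V).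
Hypothesis op_bilinear : bilinear_for *:%R *:%R op.

Lemma bilinearDl x y z : op (x + y) z = op x z + op y z.
Proof. by have := op_bilinear.1 z 1 x y; rewrite /= !scale1r. Qed.

Lemma bilinearDr x y z : op z (x + y) = op z x + op z y.
Proof. by have := op_bilinear.2 z 1 x y; rewrite /= !scale1r. Qed.

Lemma bilinear0l z : op 0 z = 0.
Proof. by apply: (addIr (op 0 z)); rewrite -bilinearDl !add0r. Qed.

Lemma bilinear0r z : op z 0 = 0.
Proof. by apply: (addIr (op z 0)); rewrite -bilinearDr !add0r. Qed.

Lemma bilinearZl c x z : op (c *: x) z = c *: op x z.
Proof.
by have := op_bilinear.1 z c x 0; rewrite /= bilinear0l !addr0.
Qed.

Lemma bilinearZr c x z : op z (c *: x) = c *: op z x.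
Proof.
by have := op_bilinear.2 z c x 0; rewrite /= bilinear0r !addr0.
Qed.

End Bilinear.

(** * Products of odd elements in a transposed Poisson superalgebra *)

Section TransposedPoisson.

Variables (K : fieldType) (L : gradedSpace K) (delta : K).
Variables (mul br : L -> L -> L).
Hypothesis tp : transposed_poisson_superalgebra delta mul br.
Hypothesis two_neq0 : 2%:R != 0 :> K.

Let mul_bil : bilinear_for *:%R *:%R mul.
Proof. by case: tp => -[[]]. Qed.

Let br_bil : bilinear_for *:%R *:%R br.
Proof. by case: tp => _ [[]]. Qed.

Let mul_homog i j x y : homog i x -> homog j y -> homog (i (+) j) (mul x y).
Proof. by case: tp => -[[_ h]] _ _ _ _; apply: h. Qed.

Let br_homog i j x y : homog i x -> homog j y -> homog (i (+) j) (br x y).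
Proof. by case: tp => _ [[_ h]] _ _ _; apply: h. Qed.

Let mulC i j x y : homog i x -> homog j y -> mul x y = ssign K i j *: mul y x.
Proof. by case: tp => -[_ _ h] _ _; apply: h. Qed.

Let brC i j x y : homog i x -> homog j y -> br x y = - (ssign K i j *: br y x).
Proof. by case: tp => _ [_ h _] _; apply: h. Qed.

Let jacobi i j k x y z : homog i x -> homog j y -> homog k z ->
  br x (br y z) = br (br x y) z + ssign K i j *: br y (br x z).
Proof. by case: tp => _ [_ _ h] _; apply: h. Qed.

Let leibniz i j k x y z : homog i x -> homog j y -> homog k z ->
  mul x (br y z) = delta *: (br (mul x y) z + ssign K i j *: br y (mul x z)).
Proof. by case: tp => _ _; apply. Qed.

Lemma mul_odd_self x : homog true x -> mul x x = 0.
Proof.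
move=> hx; have := mulC hx hx.
rewrite /ssign expr1 scaleN1r => /eqP.
rewrite -subr_eq0 opprK -mulr2n -scaler_nat scaler_eq0.
by rewrite (negPf two_neq0) => /eqP.
Qed.

(* Both sides of [x,x].[u,x] = [u,x].[x,x] reduce to multiples of
   [[x.u,x],x] = [x.u,[x,x]] / 2, with opposite signs. *)
Lemma mul_odd_centralizes x u : delta != 0 -> homog true x -> homog true u ->
  br (mul x u) (br x x) = 0.
Proof.
move=> d0 hx hu; set F := mul x u.
have hF : homog false F := mul_homog hx hu.
have hX : homog false (br x x) := br_homog hx hx.
have hw : homog false (br u x) := br_homog hu hx.
have hFx : homog true (br F x) := br_homog hF hx.
have brxF : br x F = - br F x by rewrite (brC hx hF) /ssign expr0 scale1r.
have mulux : mul u x = - F by rewrite (mulC hu hx) /ssign expr1 scaleN1r.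
have brN y z : br (- y) z = - br y z by rewrite -scaleN1r bilinearZl // scaleN1r.
have brNr y z : br y (- z) = - br y z
  by rewrite -scaleN1r bilinearZr // scaleN1r.
have brFxx : br x (br F x) = br (br F x) x.
  by rewrite (brC hx hFx) /ssign expr1 scaleN1r opprK.
have mulwx : mul (br u x) x = delta *: br F x.
  rewrite (mulC hw hx) /ssign expr0 scale1r (leibniz hx hu hx).
  by rewrite (mul_odd_self hx) (bilinear0r br_bil) scaler0 addr0.
have mulXu : mul (br x x) u = - (delta *: (br F x + br F x)).
  rewrite (mulC hX hu) /ssign expr0 scale1r (leibniz hu hx hx) mulux.
  by rewrite brN brNr brxF opprK /ssign expr1 scaleN1r -opprD scalerN.
have mulXx : mul (br x x) x = 0.
  rewrite (mulC hX hx) /ssign expr0 scale1r (leibniz hx hx hx).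
  rewrite (mul_odd_self hx) (bilinear0r br_bil) (bilinear0l br_bil).
  by rewrite scaler0 addr0 scaler0.
(* Both factors are even, so they commute; expanding each side by [leibniz] gives the two
   evaluations to compare. *)
have E : mul (br x x) (br u x) = mul (br u x) (br x x).
  by rewrite (mulC hX hw) /ssign expr0 scale1r.
have E1 : br F (br x x) = br (br F x) x + br (br F x) x.
  by rewrite (jacobi hF hx hx) /ssign expr0 scale1r brFxx.
move: E; rewrite (leibniz hX hu hx) (leibniz hw hx hx) mulXu mulXx mulwx.
rewrite (bilinear0r br_bil) scaler0 addr0 /ssign !expr0 scale1r.
rewrite brN !(bilinearZl br_bil) !(bilinearZr br_bil) brFxx.
rewrite (bilinearDl br_bil) -scalerDr -E1 => /(scalerI d0)/eqP.
(* With one [delta] cancelled, [- (delta [F,[x,x]]) = delta [F,[x,x]]] remains. *)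
rewrite eq_sym -subr_eq0 opprK -scalerDr -mulr2n -scaler_nat !scaler_eq0.
by rewrite (negPf d0) (negPf two_neq0) => /eqP.
Qed.

End TransposedPoisson.

(** * Determinants and independence in the integer plane *)

Section Det2.

Implicit Types m n c s : int * int.

Lemma det2_neq0 n m : det2 n m != 0 -> n != 0 /\ m != 0.
Proof.
by move=> h; split; apply: contraNneq h => ->; rewrite /det2 ?mul0r ?mulr0 subrr.
Qed.

(** Cramer's rule, by coordinates: [det(p,q) m = det(p,m) q - det(q,m) p]. *)
Lemma det2_indep p q m : det2 p q != 0 -> det2 p m = 0 -> det2 q m = 0 -> m = 0.
Proof.
case: p q m => [p1 p2] [q1 q2] [m1 m2]; rewrite /det2 /= => h hp hq.
have E1 : (p1 * q2 - p2 * q1) * m1 = 0.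
  transitivity (q1 * (p1 * m2 - p2 * m1) - p1 * (q1 * m2 - q2 * m1)); first by ring.
  by rewrite hp hq !mulr0 subrr.
have E2 : (p1 * q2 - p2 * q1) * m2 = 0.
  transitivity (q2 * (p1 * m2 - p2 * m1) - p2 * (q1 * m2 - q2 * m1)); first by ring.
  by rewrite hp hq !mulr0 subrr.
by move/eqP: E1; move/eqP: E2; rewrite !mulf_eq0 (negPf h) => /eqP -> /eqP ->.
Qed.

Lemma det2_avoid c m : c != 0 -> m != 0 ->
  exists n, det2 n c != 0 /\ det2 n m != 0.
Proof.
case: c m => [c1 c2] [m1 m2]; rewrite !xpair_eqE /det2 /= => hc hm.
(* Let [c' = (- c2, c1)], a quarter turn of [c]. As [det(c',c) = - |c|^2] and [det(c',m) = - c.m],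
   it works unless [c.m = 0]. Then [c + c'] does: its determinant with [m] is [det(c,m)], nonzero
   for perpendicular nonzero vectors. *)
case: (eqVneq (c1 * m1 + c2 * m2) 0) => h.
  by exists (c1 - c2, c2 + c1) => /=; split; nia.
by exists (- c2, c1) => /=; split; nia.
Qed.

Lemma det2_split c s : c != 0 ->
  exists a b, [/\ a + b = s, det2 a c != 0 & det2 b c != 0].
Proof.
case: c s => [c1 c2] [s1 s2]; rewrite !xpair_eqE /det2 /= => hc.
(* For [a = t (c2, - c1)], [det(a,c) = t |c|^2] and [det(b,c) = det(s,c) - t |c|^2]. So [t = 1]
   works unless [det(s,c) = |c|^2], and then [t = 2] does. *)
case: (eqVneq (s1 * c2 - s2 * c1 - (c1 * c1 + c2 * c2)) 0) => h.
  exists (2 * c2, - (2 * c1)), ((s1, s2) - (2 * c2, - (2 * c1))).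
  by split=> /=; [rewrite addrC subrK | nia | nia].
exists (c2, - c1), ((s1, s2) - (c2, - c1)).
by split=> /=; [rewrite addrC subrK | nia | nia].
Qed.

End Det2.

(** * Coefficients, centralizers and generation in the Kantor double *)

Section Kantor.

Variable K : numFieldType.

Local Notation LV := (LV K).
Local Notation br := (@LVbracket K).
Implicit Types (i j : bool) (m n p q r : int * int) (x y F : LV).

Let br_bil := LVbracket_bilinear K.

Lemma gen_homog i m : @homog K LV i (gen K i m).
Proof.
rewrite /gen; case: insubP => [k _ _|_]; last exact: homog0.
by move=> p; rewrite msuppU oner_eq0 in_fset1 => /eqP ->.
Qed.

Lemma LV_ind (P : LV -> Prop) : P 0 ->
  (forall c u v, P u -> P v -> P (c *: u + v)) ->
  (forall i m, m != 0 -> P (gen K i m)) -> forall x, P x.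
Proof.
move=> P0 PZD Pg x; have [u [v [hu hv ->]]] := homog_sum x.
rewrite -[u]scale1r; apply: (PZD).
  exact: (LVhomog_ind P0 PZD (Pg false) hu).
exact: (LVhomog_ind P0 PZD (Pg true) hv).
Qed.

(** This covers [m = 0], because no basis index is zero; degrees [m + p] met below may vanish. *)
Lemma gen_coef i m j (l : nzidx) :
  (gen K i m : {malg K[LVidx]})@_(j, l) = ((i == j) && (m == val l))%:R.
Proof.
rewrite /gen; case: insubP => [k _ <-|m0].
  by rewrite mcoeffU xpair_eqE (inj_eq val_inj).
rewrite mcoeff0 (_ : m == val l = false) ?andbF //.
by apply: contraNF m0 => /eqP ->; apply: (valP l).
Qed.

Lemma bracket_Lgen i m p : m != 0 -> p != 0 ->
  br (gen K i m) (Lgen K p) = (det2 p m)%:~R *: gen K i (m + p).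
Proof. by move=> m0 p0; rewrite LVbracket_gen //; case: i. Qed.

(** Bracketing with [L_p] shifts degrees by [p], so each coefficient of the result comes from a
    single coefficient of [F]. *)
Lemma bracket_Lgen_coef F p j (k l : nzidx) : p != 0 -> val l = val k + p ->
  (br F (Lgen K p) : {malg K[LVidx]})@_(j, l) =
  (det2 p (val k))%:~R * (F : {malg K[LVidx]})@_(j, k).
Proof.
move=> p0 lE; elim/LV_ind: F => [|c u v Pu Pv|i m m0].
- by rewrite (bilinear0l br_bil) !mcoeff0 mulr0.
- rewrite (bilinearDl br_bil) (bilinearZl br_bil) !mcoeffD !mcoeffZ Pu Pv.
  by rewrite mulrDr mulrCA.
rewrite bracket_Lgen // mcoeffZ !gen_coef lE (inj_eq (addIr p)).
by case: (eqVneq m (val k)) => [->|_] //; rewrite andbF !mulr0.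
Qed.

(** A coefficient of [F] in degree [k] survives only if [k] is parallel to both [p] and [q], which
    is impossible for nonzero [k]. *)
Lemma Lgen_centralizer F p q : det2 p q != 0 ->
  br F (Lgen K p) = 0 -> br F (Lgen K q) = 0 -> F = 0.
Proof.
move=> pq hp hq; have [p0 q0] := det2_neq0 pq.
have coef0 r j (k : nzidx) : r != 0 -> br F (Lgen K r) = 0 -> det2 r (val k) != 0 ->
    (F : {malg K[LVidx]})@_(j, k) = 0.
  (* If [k + r] were zero, [det(r,k)] would vanish; hence [k + r] is a genuine basis index. *)
  move=> r0 hr rk; have kr0 : val k + r != 0.
    apply: contraNneq rk => /eqP; rewrite addr_eq0 => /eqP ->.
    by rewrite /det2 /=; apply/eqP; ring.
  have := bracket_Lgen_coef F j (k := k) (l := Sub (val k + r) kr0) r0 erefl.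
  rewrite hr mcoeff0 => /esym/eqP; rewrite mulf_eq0 intr_eq0.
  by rewrite (negPf rk) => /eqP.
apply/malgP => -[j k]; rewrite mcoeff0.
case: (eqVneq (det2 p (val k)) 0) => [pk|]; last exact: coef0.
case: (eqVneq (det2 q (val k)) 0) => [qk|]; last exact: coef0.
by have := valP k; rewrite (det2_indep pq pk qk) eqxx.
Qed.

Lemma Lgen_bracket a b : a != 0 -> b != 0 ->
  Lgen K (a + b) = br (Ggen K a) (Ggen K b).
Proof. by move=> a0 b0; rewrite LVbracket_gen. Qed.

(** The degree [n] can be any vector not parallel to [m]: [det(n, m - n) = det(n, m)] stays
    invertible. *)
Lemma Ggen_bracket m n : det2 n m != 0 ->
  Ggen K m = (det2 n m)%:~R^-1 *: br (Lgen K (m - n)) (Ggen K n).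
Proof.
move=> nm; have [n0 m0] := det2_neq0 nm.
have E : det2 n (m - n) = det2 n m by rewrite /det2 /=; ring.
have [_ mn0] : n != 0 /\ m - n != 0 by apply: det2_neq0; rewrite E.
rewrite LVbracket_gen //= E subrK scalerA mulVf ?scale1r //.
by rewrite intr_eq0.
Qed.

(** * Vanishing of the product on generators *)

Section Structure.

Variables (delta : K) (mul : LV -> LV -> LV).
Hypothesis tp : transposed_poisson_superalgebra delta mul br.

Let mul_bil : bilinear_for *:%R *:%R mul.
Proof. by case: tp => -[[]]. Qed.

Let leibniz i j k x y z : homog i x -> homog j y -> homog k z ->
  mul x (br y z) = delta *: (br (mul x y) z + ssign K i j *: br y (mul x z)).
Proof. by case: tp => _ _; apply. Qed.

Let mulC i j x y : homog i x -> homog j y -> mul x y = ssign K i j *: mul y x.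
Proof. by case: tp => -[_ _ h] _ _; apply: h. Qed.

(** For [delta = 0] the Leibniz rule alone kills the product. Asking for the two vanishings only
    when [delta != 0] spares later lemmas this case distinction. *)
Let mul_bracket0 i j k x y z : homog i x -> homog j y -> homog k z ->
  (delta != 0 -> mul x y = 0) -> (delta != 0 -> mul x z = 0) ->
  mul x (br y z) = 0.
Proof.
move=> hx hy hz xy xz; rewrite (leibniz hx hy hz).
case: (eqVneq delta 0) => [->|d0]; first by rewrite scale0r.
by rewrite xy // xz // (bilinear0l br_bil) (bilinear0r br_bil) scaler0 addr0 scaler0.
Qed.

Lemma mul_GG_indep c m : delta != 0 -> det2 c m != 0 ->
  mul (Ggen K c) (Ggen K m) = 0.
Proof.
move=> d0 cm; have [c0 m0] := det2_neq0 cm.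
have two0 : 2%:R != 0 :> K by rewrite pnatr_eq0.
apply: (@Lgen_centralizer _ (c + c) (m + m)).
- by move: cm; rewrite /det2 /=; nia.
- by rewrite Lgen_bracket // (mul_odd_centralizes tp) //; apply: gen_homog.
(* The same argument with [c] and [m] exchanged; the product only changes sign. *)
rewrite Lgen_bracket // (mulC (@gen_homog true c) (@gen_homog true m)).
rewrite (bilinearZl br_bil) (mul_odd_centralizes tp) ?scaler0 //;
  exact: gen_homog.
Qed.

Lemma mul_GL c s : c != 0 -> mul (Ggen K c) (Lgen K s) = 0.
Proof.
move=> c0; have [a [b [<- ac bc]]] := det2_split s c0.
have [[a0 _] [b0 _]] := (det2_neq0 ac, det2_neq0 bc).
have det2C n m : det2 n m = - det2 m n by rewrite /det2; ring.
rewrite Lgen_bracket //; apply: mul_bracket0; try exact: gen_homog;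
  by move=> d0; apply: mul_GG_indep => //; rewrite det2C oppr_eq0.
Qed.

(** Take [n] parallel to neither [c] nor [m]. Then [G_m] is a multiple of [[L_(m-n), G_n]], and
    [G_c] annihilates [L_(m-n)] by [mul_GL] and, for [delta != 0], [G_n] by [mul_GG_indep]. *)
Lemma mul_GG c m : c != 0 -> m != 0 -> mul (Ggen K c) (Ggen K m) = 0.
Proof.
move=> c0 m0; have [n [nc nm]] := det2_avoid c0 m0.
rewrite (Ggen_bracket nm) (bilinearZr mul_bil) (_ : mul _ _ = 0) ?scaler0 //.
apply: mul_bracket0; try exact: gen_homog; first by rewrite mul_GL.
move=> d0; apply: mul_GG_indep => //.
by move: nc; rewrite /det2; nia.
Qed.

Lemma mul_LG k m : m != 0 -> mul (Lgen K k) (Ggen K m) = 0.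
Proof.
move=> m0; rewrite (mulC (@gen_homog false k) (@gen_homog true m)).
by rewrite mul_GL ?scaler0.
Qed.

Lemma mul_LL k s : s != 0 -> mul (Lgen K k) (Lgen K s) = 0.
Proof.
(* Splitting [s] relative to itself serves to make [a] and [b] nonzero, so that [mul_LG] applies to
   [G_a] and [G_b]. *)
move=> s0; have [a [b [<- ac bc]]] := det2_split s s0.
have [[a0 _] [b0 _]] := (det2_neq0 ac, det2_neq0 bc).
by rewrite Lgen_bracket //; apply: mul_bracket0; try exact: gen_homog;
  rewrite mul_LG.
Qed.

Lemma LV_mul_eq0 x y : mul x y = 0.
Proof.
elim/LV_ind: x => [|c u v Pu Pv|i m m0]; first exact: bilinear0l.
  by rewrite (bilinearDl mul_bil) (bilinearZl mul_bil) Pu Pv scaler0 addr0.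
elim/LV_ind: y => [|c u v Pu Pv|j n n0]; first exact: bilinear0r.
  by rewrite (bilinearDr mul_bil) (bilinearZr mul_bil) Pu Pv scaler0 addr0.
by case: i; case: j; [apply: mul_GG | apply: mul_GL | apply: mul_LG | apply: mul_LL].
Qed.

End Structure.

End Kantor.

Theorem theorem4p10 (R : realType) (delta : complex R)
    (mul : LV (complex R) -> LV (complex R) -> LV (complex R)) :
  transposed_poisson_superalgebra delta mul (@LVbracket (complex R)) ->
  trivial_structure mul (@LVbracket (complex R)).
Proof. by move=> tp; left=> x y; apply: (LV_mul_eq0 tp). Qed.
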